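(* Let $N\ge 3$ and let $\mathcal{X}\in\mathbb{R}^{I_1\times I_2\times\cdots\times I_N}$ be a nonzero tensor with $\mathrm{TuckRank}(\mathcal{X})=(t_1,t_2,\dots,t_N)$. Let $$\mathcal{X}=\mathcal{D}\times_1\mathbf{U}_1\times_2\mathbf{U}_2\times\cdots\times_N\mathbf{U}_N$$ be a Tucker decomposition of $\mathcal{X}$ with core tensor $\mathcal{D}\in\mathbb{R}^{t_1\times t_2\times\cdots\times t_N}$ and factor matrices $\mathbf{U}_n\in\mathbb{R}^{I_n\times t_n}$, $n=1,\dots,N$. If $\mathbf{U}_i^{\top}\mathbf{U}_i$ is invertible for every $i=1,\dots,N$, then $$\mathrm{MtpRank}(\mathcal{X})=\mathrm{MtpRank}(\mathcal{D}),$$ and every component of this vector is at most $\mathrm{submax}\{t_1,t_2,\dots,t_N\}$.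
   Context: $\mathrm{TuckRank}(\mathcal{X})=(t_1,\dots,t_N)$ where $t_n$ is the matrix rank of the mode-$n$ unfolding $\mathcal{X}_{(n)}$ (the matrix with rows indexed by the $n$-th index and columns by the remaining indices). The mode-$n$ product $\mathcal{D}\times_n\mathbf{U}$ is defined by $(\mathcal{D}\times_n\mathbf{U})_{i_1\dots i_{n-1}ji_{n+1}\dots i_N}=\sum_{i_n}\mathcal{D}_{i_1\dots i_N}\mathbf{U}_{ji_n}$. $\mathrm{submax}$ denotes the second largest element of a list, counted with multiplicity. Multiple product: for positive integers $r_1,\dots,r_N$ and $N$-order real tensors $\mathcal{A}_n$ of size $r_1\times\cdots\times r_{n-1}\times I_n\times r_{n+1}\times\cdots\times r_N$ ($n=1,\dots,N$), the tensor $[\mathcal{A}_1\mathcal{A}_2\cdots\mathcal{A}_N]\in\mathbb{R}^{I_1\times\cdots\times I_N}$ is defined by $$[\mathcal{A}_1\cdots\mathcal{A}_N]_{i_1\dots i_N}=\sum_{p_1=1}^{r_1}\cdots\sum_{p_N=1}^{r_N}(\mathcal{A}_1)_{i_1p_2\dots p_N}(\mathcal{A}_2)_{p_1i_2p_3\dots p_N}\cdots(\mathcal{A}_N)_{p_1\dots p_{N-1}i_N},$$ where $\mathcal{A}_n$ carries $i_n$ in position $n$ and $p_m$ in each position $m\neq n$. A vector $(r_1,\dots,r_N)$ of positive integers is called admissible for a tensor $\mathcal{X}\in\mathbb{R}^{I_1\times\cdots\times I_N}$ (of arbitrary dimensions $I_1,\dots,I_N$) if $\mathcal{X}=[\mathcal{A}_1\cdots\mathcal{A}_N]$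 for some real factor tensors $\mathcal{A}_n\in\mathbb{R}^{r_1\times\cdots\times r_{n-1}\times I_n\times r_{n+1}\times\cdots\times r_N}$, $n=1,\dots,N$. $\mathrm{GTriRank}(\mathcal{X})$ (generalized triple rank), for nonzero $\mathcal{X}$, is the smallest positive integer $r$ such that $(r,r,\dots,r)$ is admissible for $\mathcal{X}$ (such $r$ always exists when $N\geq 3$). $\mathrm{MtpRank}(\mathcal{X})$ (Multiple rank), for nonzero $\mathcal{X}$, is the vector $\mathbf{r}=(r_1,\dots,r_N)$ that is admissible, satisfies $r_i\le\mathrm{GTriRank}(\mathcal{X})$ for all $i$, and has the smallest $\ell_1$ norm $r_1+\cdots+r_N$ among all such vectors; among several vectors with the same minimal $\ell_1$ norm, the lexicographically smallest one is taken. *)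

(* Defs.v *)
From mathcomp Require Import all_boot all_order all_algebra.
From mathcomp Require Import boolp classical_sets reals.

Set Implicit Arguments.
Unset Strict Implicit.
Unset Printing Implicit Defensive.

Import Order.TTheory GRing.Theory Num.Theory.
Local Open Scope ring_scope.

(* Modes and indices are numbered from 0 rather than from 1.                  *)

Definition midx (N : nat) (d : 'I_N -> nat) : Type :=
  {dffun forall n : 'I_N, 'I_(d n)}.

Definition tensor (R : Type) (N : nat) (d : 'I_N -> nat) : Type :=
  {ffun {dffun forall n : 'I_N, 'I_(d n)} -> R}.

(* The indices of all modes but n.                                            *)
Definition ridx (N : nat) (d : 'I_N -> nat) (n : 'I_N) : Type :=
  {dffun forall m : {m : 'I_N | m != n}, 'I_(d (val m))}.

Definition ins_idx (N : nat) (d : 'I_N -> nat) (n : 'I_N)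
    (k : 'I_(d n)) (q : ridx d n) : midx d :=
  finfun (fun m : 'I_N =>
    match eqVneq m n return 'I_(d m) with
    | EqNotNeq e => cast_ord (congr1 d (esym e)) k
    | NeqNotEq e => q (exist _ m e)
    end).

Definition unfolding (R : Type) (N : nat) (d : 'I_N -> nat)
    (X : tensor R d) (n : 'I_N) : 'M[R]_(d n, #|{: ridx d n}|) :=
  \matrix_(k, c) X (ins_idx k (enum_val c)).

Definition TuckRank (R : fieldType) (N : nat) (d : 'I_N -> nat)
    (X : tensor R d) : N.-tuple nat :=
  [tuple \rank (unfolding X n) | n < N].

(* The mode-n product changes the n-th dimension only, from [d n] to [d' n].   *)
Definition del_idx (N : nat) (d d' : 'I_N -> nat) (n : 'I_N)
    (dd' : forall m, m != n -> d' m = d m) (i : midx d') : ridx d n :=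
  finfun (fun m : {m : 'I_N | m != n} =>
    cast_ord (dd' (val m) (valP m)) (i (val m)) : 'I_(d (val m))).

Definition mode_prod (R : pzSemiRingType) (N : nat) (d d' : 'I_N -> nat)
    (n : 'I_N) (dd' : forall m, m != n -> d' m = d m)
    (D : tensor R d) (U : 'M[R]_(d' n, d n)) : tensor R d' :=
  [ffun i : midx d' =>
    \sum_(k < d n) D (ins_idx k (del_idx dd' i)) * U (i n) k].

(* Dimensions after the first k mode products of a Tucker decomposition.      *)
Definition stage (N : nat) (I t : 'I_N -> nat) (k : nat) (m : 'I_N) : nat :=
  if (m < k)%N then I m else t m.

Lemma stage_new (N : nat) (I t : 'I_N -> nat) (n : 'I_N) :
  I n = stage I t n.+1 n.
Proof. by rewrite /stage ltnSn. Qed.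

Lemma stage_old (N : nat) (I t : 'I_N -> nat) (n : 'I_N) : t n = stage I t n n.
Proof. by rewrite /stage ltnn. Qed.

Lemma stage_neq (N : nat) (I t : 'I_N -> nat) (n m : 'I_N) :
  m != n -> stage I t n.+1 m = stage I t n m.
Proof. by move=> ne; rewrite /stage ltnS leq_eqVlt val_eqE (negbTE ne). Qed.

Lemma stage_last (N : nat) (I t : 'I_N -> nat) (m : 'I_N) :
  stage I t N m = I m.
Proof. by rewrite /stage ltn_ord. Qed.

(* D x_1 U_1 x_2 ... x_k U_k *)
Fixpoint mode_prods (R : pzSemiRingType) (N : nat) (I t : 'I_N -> nat)
    (D : tensor R t) (U : forall n : 'I_N, 'M[R]_(I n, t n)) (k : nat) :
    (k <= N)%N -> tensor R (stage I t k) :=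
  match k return (k <= N)%N -> tensor R (stage I t k) with
  | 0%N => fun _ => D
  | k'.+1 => fun kN =>
      mode_prod (@stage_neq N I t (Ordinal kN)) (mode_prods D U (ltnW kN))
        (castmx (stage_new I t (Ordinal kN), stage_old I t (Ordinal kN))
           (U (Ordinal kN)))
  end.

Definition cast_tensor (R : Type) (N : nat) (d d' : 'I_N -> nat)
    (dd' : forall m, d' m = d m) (X : tensor R d) : tensor R d' :=
  [ffun i : midx d' =>
    X (finfun (fun m : 'I_N => cast_ord (dd' m) (i m) : 'I_(d m)))].

(* D x_1 U_1 x_2 U_2 ... x_N U_N *)
Definition tucker (R : pzSemiRingType) (N : nat) (I t : 'I_N -> nat)
    (D : tensor R t) (U : forall n : 'I_N, 'M[R]_(I n, t n)) : tensor R I :=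
  cast_tensor (fun m => esym (stage_last I t m)) (mode_prods D U (leqnn N)).

Lemma ins_idx_eq (N : nat) (d : 'I_N -> nat) (n : 'I_N)
    (k : 'I_(d n)) (q : ridx d n) (m : 'I_N) : m = n ->
  ins_idx k q m = k :> nat.
Proof. by move=> ->; rewrite ffunE; case: eqVneq => // e; by case/negP: (e). Qed.

Lemma ins_idx_neq (N : nat) (d : 'I_N -> nat) (n : 'I_N)
    (k : 'I_(d n)) (q : ridx d n) (m : 'I_N) (h : m != n) :
  ins_idx k q m = q (exist _ m h).
Proof.
rewrite ffunE; case: eqVneq => [e|e]; first by case/negP: (h); apply/eqP.
by congr (q (exist _ _ _)); apply: bool_irrelevance.
Qed.

Lemma mode_prodsE (R : comPzSemiRingType) (N : nat) (I t : 'I_N -> nat)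
    (D : tensor R t) (U : forall n : 'I_N, 'M[R]_(I n, t n)) (k : nat)
    (kN : (k <= N)%N) (i : midx (stage I t k)) (j : midx I) :
  (forall m : 'I_N, (m < k)%N -> i m = j m :> nat) ->
  mode_prods D U kN i =
  \sum_(p : {dffun forall m : 'I_N, 'I_(t m)}
       | [forall m : 'I_N, (k <= m)%N ==> (p m == i m :> nat)])
     D p * \prod_(m < N | (m < k)%N) U m (j m) (p m).
Proof.
elim: k kN i => [|k IH] kN i ij.
  rewrite (big_pred1 i) ?big1 ?mulr1 // => p.
  apply/forallP/eqP => [h|-> m]; last by rewrite eqxx implybT.
  by apply/ffunP => m; apply/val_inj/eqP; apply: h.
rewrite /= ffunE; set n := Ordinal kN.
rewrite [RHS](partition_big (fun p : {dffun forall m : 'I_N, 'I_(t m)} => p n)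
  xpredT) //=.
pose co := cast_ord (stage_old I t n).
rewrite (reindex co) /=; last first.
  by exists (cast_ord (esym (stage_old I t n))) => x _; apply/val_inj.
apply: eq_bigr => c _.
rewrite (IH _ _); last first.
  move=> m mk; have mn : m != n by rewrite -val_eqE /= ltn_eqF.
  by rewrite (ins_idx_neq _ _ mn) ffunE /= ij // ltnW.
rewrite big_distrl /=; apply: eq_big => [p|p].
  apply/forallP/andP.
    move=> h; split.
      apply/forallP => m; apply/implyP => km; have mn : m != n by rewrite -val_eqE /= gtn_eqF.
      have /implyP/(_ (ltnW km)) := h m.
      by rewrite (ins_idx_neq _ _ mn) ffunE.
    have /implyP/(_ (leqnn _)) := h n.
    by rewrite (ins_idx_eq _ _ (erefl n)).
  case=> /forallP h /eqP pc m; apply/implyP.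
  rewrite leq_eqVlt => /orP[/eqP km|km].
    have mn : m = n by apply: val_inj.
    by rewrite (ins_idx_eq _ _ mn) /= -pc mn.
  have mn : m != n by rewrite -val_eqE /= gtn_eqF.
  rewrite (ins_idx_neq _ _ mn) ffunE /=.
  by have /implyP/(_ km) := h m.
move=> /forallP h.
have pc : p n = c.
  apply/val_inj/eqP; have /implyP/(_ (leqnn _)) := h n.
  by rewrite (ins_idx_eq _ _ (erefl n)).
rewrite -mulrA; congr (_ * _).
rewrite [RHS](bigD1 n) //= mulrC castmxE /=; congr (U _ _ _ * _).
- by apply/val_inj; rewrite /= ij.
- by rewrite pc; apply/val_inj.
- by apply: eq_bigl => m; rewrite ltnS -val_eqE /= ltn_neqAle andbC.
Qed.

Lemma tuckerE (R : comPzSemiRingType) (N : nat) (I t : 'I_N -> nat)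
    (D : tensor R t) (U : forall n : 'I_N, 'M[R]_(I n, t n)) (i : midx I) :
  tucker D U i =
  \sum_(p : {dffun forall m : 'I_N, 'I_(t m)}) D p * \prod_(m < N) U m (i m) (p m).
Proof.
rewrite ffunE (@mode_prodsE _ _ _ _ _ _ _ _ _ i); last first.
  by move=> m _; rewrite ffunE.
apply: eq_big => [p|p _].
  by apply/forallP => m; rewrite leqNgt ltn_ord.
by congr (_ * _); apply: eq_bigl => m; rewrite ltn_ord.
Qed.

(* Dimensions r_1, ..., r_(n-1), I_n, r_(n+1), ..., r_N of the n-th factor.   *)
Definition factor_dim (N : nat) (I r : 'I_N -> nat) (n m : 'I_N) : nat :=
  if m == n then I m else r m.

Definition factor_idx (N : nat) (I r : 'I_N -> nat) (n : 'I_N)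
    (i : midx I) (p : midx r) : midx (factor_dim I r n) :=
  finfun (fun m : 'I_N =>
    if m == n as b return 'I_(if b then I m else r m) then i m else p m).

Definition multiple_prod (R : comPzSemiRingType) (N : nat) (I r : 'I_N -> nat)
    (A : forall n : 'I_N, tensor R (factor_dim I r n)) : tensor R I :=
  [ffun i : midx I =>
    \sum_(p : {dffun forall m : 'I_N, 'I_(r m)})
      \prod_(n < N) A n (factor_idx n i p)].

Definition admissible (R : comPzSemiRingType) (N : nat) (I : 'I_N -> nat)
    (X : tensor R I) (r : N.-tuple nat) : Prop :=
  (forall n, (0 < tnth r n)%N) /\
  exists A : forall n : 'I_N, tensor R (factor_dim I (tnth r) n),
    X = multiple_prod A.

Definition is_GTriRank (R : comPzSemiRingType) (N : nat) (I : 'I_N -> nat)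
    (X : tensor R I) (r : nat) : Prop :=
  [/\ (0 < r)%N, admissible X [tuple of nseq N r] &
      forall s, (0 < s)%N -> admissible X [tuple of nseq N s] -> (r <= s)%N].

(* The value 0 is only taken when no (r, ..., r) is admissible, which does    *)
(* not happen when 2 < N: see GTriRankP.                                      *)
Definition GTriRank (R : comPzSemiRingType) (N : nat) (I : 'I_N -> nat)
    (X : tensor R I) : nat :=
  xget 0%N [set r : nat | is_GTriRank X r]%classic.

Definition MtpRank_candidate (R : comPzSemiRingType) (N : nat)
    (I : 'I_N -> nat) (X : tensor R I) (r : N.-tuple nat) : Prop :=
  admissible X r /\ forall n, (tnth r n <= GTriRank X)%N.

Definition is_MtpRank (R : comPzSemiRingType) (N : nat) (I : 'I_N -> nat)
    (X : tensor R I) (r : N.-tuple nat) : Prop :=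
  MtpRank_candidate X r /\
  forall s : N.-tuple nat, MtpRank_candidate X s ->
    (sumn r <= sumn s)%N /\
    (sumn s = sumn r -> ((r : N.-tuplelexi nat) <= s)%O).

(* The zero vector is a junk value, not taken when 2 < N: see MtpRankP.       *)
Definition MtpRank (R : comPzSemiRingType) (N : nat) (I : 'I_N -> nat)
    (X : tensor R I) : N.-tuple nat :=
  xget [tuple of nseq N 0%N] [set r : N.-tuple nat | is_MtpRank X r]%classic.

Lemma factor_idxN (N : nat) (I r : 'I_N -> nat) (n m : 'I_N) (i : midx I)
   (p : midx r) : m != n -> factor_idx n i p m = p m :> nat.
Proof. rewrite ffunE /factor_dim; by case: (m == n). Qed.
Lemma factor_idxK (N : nat) (I r : 'I_N -> nat) (n m : 'I_N) (i : midx I)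
   (p : midx r) : m = n -> factor_idx n i p m = i m :> nat.
Proof. move=> /eqP; rewrite ffunE /factor_dim; by case: (m == n). Qed.

Lemma admissible_large (R : comPzSemiRingType) (N : nat) (I : 'I_N -> nat)
    (X : tensor R I) (r : N.-tuple nat) : (3 <= N)%N ->
  (forall n, 0 < tnth r n)%N -> (forall m n, I m <= tnth r n)%N ->
  admissible X r.
Proof.
move=> N3 r0 Ir; split=> //.
have [N1 N2] : (0 < N)%N /\ (1 < N)%N by split; apply: leq_trans N3.
pose z := Ordinal N1; pose u := Ordinal N2; pose l := Ordinal N3.
(* cyclic shift of the nonzero modes *)
pose nx (n : 'I_N) : 'I_N := if insub n.+1 is Some m then m else u.
have nxE (n : 'I_N) : nx n = (if (n.+1 < N)%N then n.+1 else 1%N) :> nat.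
  by rewrite /nx; case: insubP => [x -> -> //|/negbTE ->].
have nxz n : nx n != z by rewrite -val_eqE /= nxE; case: ifP.
have nxn n : n != z -> nx n != n.
  rewrite -!val_eqE /= nxE => n0; case: ifP => [_|nN]; first by rewrite gtn_eqF.
  have := ltn_ord n; case: (val n =P 1%N) nN => [-> | ne _ _]; first by rewrite N3.
  by apply/eqP => e; apply: ne.
have nxI : {in [pred n | n != z] &, injective nx}.
  move=> a b; rewrite !inE -!val_eqE /= => a0 b0 /(congr1 val); rewrite /= !nxE.
  case: ifP => ha; case: ifP => hb //.
  - by case=> ab; apply: val_inj.
  - by case=> a0'; rewrite a0' in a0.
  - by case=> b0'; rewrite -b0' in b0.
  - move=> _; apply: val_inj.
    have ea : a.+1 = N by apply/eqP; rewrite eqn_leq ltn_ord leqNgt ha.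
    have eb : b.+1 = N by apply/eqP; rewrite eqn_leq ltn_ord leqNgt hb.
    by apply: succn_inj; exact: (etrans ea (esym eb)).
pose A n : tensor R (factor_dim I (tnth r) n) := [ffun q : midx (factor_dim I (tnth r) n) =>
  if n == z then \sum_(j : {dffun forall m : 'I_N, 'I_(I m)} |
     (j z == q z :> nat) && [forall m : 'I_N, (m != z) ==> (j m == q (nx m) :> nat)]) X j
  else ((q (nx n) == q n :> nat) && ((n == u) ==> (q z == 0 :> nat)))%:R].
exists A; apply/ffunP => i; rewrite ffunE.
pose inv (m : 'I_N) : 'I_N := odflt z [pick n | (n != z) && (nx n == m)].
have invK n : n != z -> inv (nx n) = n.
  move=> n0; rewrite /inv; case: pickP => [x /andP[x0 /eqP]|/(_ n)].
    by move/nxI => -> //; rewrite inE.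
  by rewrite n0 eqxx.
pose pv (m : 'I_N) : nat := if m == z then 0%N else i (inv m).
have pvr m : (pv m < tnth r m)%N.
  rewrite /pv; case: ifP => _; first exact: r0.
  exact: leq_trans (ltn_ord _) (Ir _ _).
pose p0 : {dffun forall m : 'I_N, 'I_(tnth r m)} := finfun (fun m => Ordinal (pvr m)).
have p0z : p0 z = 0%N :> nat by rewrite ffunE /= /pv eqxx.
have p0n n : n != z -> p0 (nx n) = i n :> nat.
  by move=> n0; rewrite ffunE /= /pv (negbTE (nxz n)) invK.
rewrite (bigD1 p0) //= [X in _ = _ + X]big1 ?addr0.
  rewrite (bigD1 z) //= big1 ?mulr1; last first.
    move=> n n0; rewrite ffunE (negbTE n0) factor_idxN ?nxn //.
    rewrite factor_idxK // p0n // eqxx /= factor_idxN 1?eq_sym //.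
    by rewrite p0z eqxx implybT.
  rewrite ffunE eqxx (big_pred1 i) // => j; rewrite factor_idxK //.
  apply/andP/eqP => [[/eqP jz /forallP h]|->].
    apply/ffunP => m; apply/val_inj => /=; case: (altP (m =P z)) => [->//|mz].
    have /implyP/(_ mz)/eqP -> := h m.
    by rewrite factor_idxN // p0n.
  split=> //; apply/forallP => m; apply/implyP => mz.
  by rewrite factor_idxN // p0n.
move=> p /eqP pp0.
have [h|/forallPn[n]] := boolP [forall n : 'I_N, (n != z) ==>
    ((p (nx n) == i n :> nat) && ((n == u) ==> (p z == 0 :> nat)))]; last first.
  rewrite negb_imply => /andP[n0 /negbTE h].
  rewrite (bigD1 n) //= ffunE (negbTE n0) factor_idxN ?nxn //.
  rewrite factor_idxK // factor_idxN 1?eq_sym //. by rewrite [i n == _ :> nat]eq_sym h mul0r.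
exfalso; apply: pp0; apply/ffunP => m; apply/val_inj => /=.
have sur m' : m' != z -> exists2 n, n != z & nx n = m'.
  move=> m0; have [m1|m1] := eqVneq m' u.
    have h1 : (N.-1 < N)%N by rewrite ltn_predL.
    exists (Ordinal h1); first by rewrite -val_eqE /= -lt0n ltn_predRL.
    by apply: val_inj; rewrite /= nxE /= prednK // ltnn m1.
  have h1 : (m'.-1 < N)%N by apply: leq_ltn_trans (leq_pred _) (ltn_ord m').
  have m2 : (1 < m')%N by move: m0 m1; rewrite -!val_eqE /=; case: (nat_of_ord m') => [|[]].
  exists (Ordinal h1); first by rewrite -val_eqE /= -lt0n ltn_predRL.
  by apply: val_inj; rewrite /= nxE /= prednK ?ltn_ord // ltnW.
have [->|mz] := eqVneq m z.
  have /implyP/(_ isT)/andP[_] := forallP h u.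
  by rewrite eqxx p0z => /eqP.
have [n n0 <-] := sur m mz; rewrite p0n //.
by have /implyP/(_ n0)/andP[/eqP] := forallP h n.
Qed.

Lemma GTriRankP (R : comPzSemiRingType) (N : nat) (I : 'I_N -> nat)
    (X : tensor R I) : (3 <= N)%N -> is_GTriRank X (GTriRank X).
Proof.
move=> N3; apply: (@xgetPex _ 0%N [set r : nat | is_GTriRank X r]%classic).
have ex : exists s, (0 < s)%N && `[< admissible X [tuple of nseq N s] >].
  exists (\max_n I n).+1; rewrite /=; apply/asboolP/admissible_large => //.
    by move=> n; rewrite tnth_nseq.
  by move=> m n; rewrite tnth_nseq leqW // (leq_bigmax m).
case: (ex_minnP ex) => s /andP[s0 /asboolP As] min.
exists s; split=> // s' s'0 As'; apply: min; rewrite s'0; exact/asboolP.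
Qed.

Lemma MtpRankP (R : comPzSemiRingType) (N : nat) (I : 'I_N -> nat)
    (X : tensor R I) : (3 <= N)%N -> is_MtpRank X (MtpRank X).
Proof.
move=> N3; apply: (@xgetPex _ _ [set r : N.-tuple nat | is_MtpRank X r]%classic).
have [g0 Ag _] := GTriRankP X N3; set g := GTriRank X in g0 Ag.
pose F (f : {ffun 'I_N -> 'I_g.+1}) : N.-tuple nat := [tuple (f n : nat) | n < N].
have FE r : MtpRank_candidate X r -> exists f, r = F f.
  case=> _ h; exists [ffun n => inord (tnth r n)].
  by apply: eq_from_tnth => n; rewrite tnth_mktuple ffunE inordK // ltnS h.
pose P f := `[< MtpRank_candidate X (F f) >].
have C0 : MtpRank_candidate X [tuple of nseq N g].
  by split=> // n; rewrite tnth_nseq.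
have [f0 f0E] := FE _ C0.
have Pf0 : P f0 by apply/asboolP; rewrite -f0E.
case: (arg_minnP (fun f => sumn (F f)) Pf0) => f1 Pf1 min1.
pose Q f := P f && (sumn (F f) == sumn (F f1)).
have Qf1 : Q f1 by rewrite /Q Pf1 eqxx.
case: (@arg_minP _ _ _ f1 Q (fun f => F f : N.-tuplelexi nat) Qf1) => f2.
move=> /andP[/asboolP C2 /eqP s2] min2.
exists (F f2); split=> // s Cs; have [f sE] := FE _ Cs.
have Pf : P f by apply/asboolP; rewrite -sE.
rewrite sE; split=> [|s12]; first by rewrite s2; apply: min1.
by apply: min2; rewrite /Q Pf s12 s2 eqxx.
Qed.

Lemma is_MtpRank_uniq (R : comPzSemiRingType) (N : nat) (I : 'I_N -> nat)
    (X : tensor R I) (r s : N.-tuple nat) :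
  is_MtpRank X r -> is_MtpRank X s -> r = s.
Proof.
move=> [Cr hr] [Cs hs].
have [l1 rs] := hr _ Cs; have [l2 sr] := hs _ Cr.
have e : sumn s = sumn r by apply/eqP; rewrite eqn_leq l1 l2.
by apply: (@le_anti _ (N.-tuplelexi nat)); rewrite rs // sr.
Qed.

Definition submax (s : seq nat) : nat := nth 0%N (sort geq s) 1.

(* Main.v *)
Require Import Defs.
From mathcomp Require Import all_boot all_order all_fingroup all_algebra.
From mathcomp Require Import reals.

Import GRing.Theory.
Local Open Scope ring_scope.

(** The generalized triple rank and the multiple rank of a tensor depend only
    on its set of admissible vectors, so both claims are about admissibility.

    A mode product with a matrix U_n can be absorbed in the n-th factor of a
    multiple product, since the n-th index occurs in that factor alone; hence
    every vector admissible for D is admissible for X = tucker D U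
    [admissible_tucker]. Conversely D is obtained from X in the same way, by the
    matrices (U_n^T U_n)^-1 U_n^T, which are left inverses of the U_n
    [admissible_tucker_inj]. So X and D have the same admissible vectors and
    the same multiple rank [MtpRank_congr].

    As the components of the multiple rank never exceed the generalized triple
    rank, the bound follows once (b, ..., b) is shown admissible for D, where
    b = submax t. All dimensions of D but one, say t_z, are at most b
    [leq_submax_but_one]. The factor of mode z sees i_z directly and has to
    learn the other i_n through the summation indices; a permutation s of the
    modes that fixes z and moves every other mode does this: the factor of a
    mode n != z forces p_(s n) = i_n, and the factor of mode z reads all these
    p_(s n) and returns the corresponding entry of D. Only the indices
    i_n with n != z are transmitted, so summation ranges of length b suffice
    [admissible_but_one]. *)

Set Implicit Arguments.
Unset Strict Implicit.

(** Distributivity when the range of the summation index varies with the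
    factor, as the range of i_n varies with the mode n. *)
Lemma prod_sum_dffun (R : comPzSemiRingType) (J : finType) (T : J -> finType)
    (F : forall j, T j -> R) :
  \prod_j \sum_(k : T j) F j k =
  \sum_(f : {dffun forall j, T j}) \prod_j F j (f j).
Proof.
(* Both sides are moved to sums over functions into the disjoint union of
   the T j, where distributivity for a constant codomain applies. *)
under eq_bigr => j _ do rewrite (big_tag F j).
rewrite bigA_distr_big_dep.
rewrite (reindex (@dffun_of_fprod J T)); last exact/onW_bij/dffun_of_fprod_bij.
pose F' j : {ffun T j -> R} := [ffun k => F j k].
transitivity (\sum_(f in family (tagged_with T)) \prod_j untag 0 (F' j) (f j)).
  apply: eq_bigr => f _; apply: eq_bigr => j _; rewrite /untag.
  by case: eqP => // e; rewrite ffunE.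
rewrite -big_fprod; apply: eq_bigr => f _; apply: eq_bigr => j _.
by rewrite !ffunE.
Qed.

Lemma tucker_comp (R : comPzSemiRingType) (N : nat) (J I t : 'I_N -> nat)
    (D : tensor R t) (U : forall n, 'M[R]_(I n, t n))
    (V : forall n, 'M[R]_(J n, I n)) :
  tucker (tucker D U) V = tucker D (fun n => V n *m U n).
Proof.
apply/ffunP => i; rewrite !tuckerE.
under eq_bigr => q _ do rewrite tuckerE big_distrl /=.
rewrite exchange_big /=; apply: eq_bigr => p _.
under [in RHS]eq_bigr => n _ do rewrite mxE.
rewrite (prod_sum_dffun (fun n k => V n (i n) k * U n k (p n))) big_distrr /=.
by apply: eq_bigr => q _; rewrite big_split /= -mulrA; congr (_ * _); rewrite mulrC.
Qed.

Lemma tucker1 (R : comPzSemiRingType) (N : nat) (t : 'I_N -> nat)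
    (D : tensor R t) : tucker D (fun n => 1%:M) = D.
Proof.
apply/ffunP => i; rewrite tuckerE (bigD1 i) //= [X in _ + X]big1 ?addr0.
  by rewrite big1 ?mulr1 // => n _; rewrite mxE eqxx.
move=> p pi; have /existsP[n ne] : [exists n, i n != p n].
  apply/existsPn => ip; case/negP: pi; apply/eqP/ffunP => n.
  by have /negPn/eqP := ip n.
by rewrite (bigD1 n) //= mxE (negbTE ne) mul0r mulr0.
Qed.

Lemma eq_factor_idx (N : nat) (I r : 'I_N -> nat) (n : 'I_N)
    (i i' : midx I) (p p' : midx r) :
    i n = i' n -> (forall m, m != n -> p m = p' m) ->
  factor_idx n i p = factor_idx n i' p'.
Proof.
move=> ii pp; apply/ffunP => m; apply/val_inj => /=.
have [mn|mn] := eqVneq m n; first by rewrite !factor_idxK // mn ii.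
by rewrite !factor_idxN // pp.
Qed.

(** The n-th factor of a multiple product, seen as a function of the index k of
    mode n and of a full summation index p on whose n-th component it does not
    depend. Factors are easier to build in this form, where all factors share
    the index p instead of each having its own index type. *)
Lemma admissibleP (R : comPzSemiRingType) (N : nat) (I : 'I_N -> nat)
    (X : tensor R I) (r : N.-tuple nat) :
  admissible X r <->
  (forall n, (0 < tnth r n)%N) /\
  exists B : forall n, 'I_(I n) -> midx (tnth r) -> R,
    (forall n k (p p' : midx (tnth r)),
        (forall m, m != n -> p m = p' m) -> B n k p = B n k p') /\
    forall i, X i =
      \sum_(p : {dffun forall m, 'I_(tnth r m)}) \prod_n B n (i n) p.
Proof.
split=> -[r0]; last first.
  move=> [B [Bind XB]]; split=> //.
  (* The missing n-th component is filled with 0, which exists since r_n > 0. *)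
  pose fill n (q : midx (factor_dim I (tnth r) n)) : midx (tnth r) :=
    finfun (fun m => insubd (Ordinal (r0 m)) (q m : nat)).
  have qn n : factor_dim I (tnth r) n n = I n by rewrite /factor_dim eqxx.
  exists (fun n => [ffun q : midx (factor_dim I (tnth r) n) =>
    B n (cast_ord (qn n) (q n)) (fill n q)]).
  apply/ffunP => i; rewrite XB ffunE; apply: eq_bigr => p _.
  apply: eq_bigr => n _; rewrite ffunE.
  rewrite (_ : cast_ord _ _ = i n); last by apply/val_inj; rewrite /= factor_idxK.
  apply: Bind => m mn; rewrite ffunE factor_idxN //.
  by apply/val_inj; rewrite val_insubd ltn_ord.
move=> [A XA]; split=> //.
(* A full index i with i n = k is only needed to form the argument of A n; the
   value does not depend on its choice. When there is none, X has no entries. *)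
exists (fun n k p => if [pick i : {dffun forall m, 'I_(I m)} | i n == k]
  is Some i then A n (factor_idx n i p) else 0).
split=> [n k p p' pp|i].
  by case: pickP => // i _; rewrite (@eq_factor_idx _ _ _ n i i p p').
rewrite XA ffunE; apply: eq_bigr => p _; apply: eq_bigr => n _.
case: pickP => [j /eqP jn|/(_ i)]; last by rewrite eqxx.
by rewrite (@eq_factor_idx _ _ _ n i j p p).
Qed.

(** The n-th new factor is the mode-n product of the old one with U n. *)
Lemma admissible_tucker (R : comPzSemiRingType) (N : nat)
    (I t : 'I_N -> nat) (D : tensor R t) (U : forall n, 'M[R]_(I n, t n))
    (r : N.-tuple nat) :
  admissible D r -> admissible (tucker D U) r.
Proof.
case/admissibleP=> r0 [B [Bind DB]]; apply/admissibleP; split=> //.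
exists (fun n k p => \sum_(l < t n) B n l p * U n k l); split=> [n k p p' pp|i].
  by apply: eq_bigr => l _; rewrite (Bind _ _ p p').
rewrite tuckerE; under eq_bigr => q _ do rewrite DB big_distrl /=.
rewrite exchange_big /=; apply: eq_bigr => p _.
rewrite (prod_sum_dffun (fun n l => B n l p * U n (i n) l)).
by apply: eq_bigr => q _; rewrite big_split.
Qed.

Lemma admissible_tucker_inj (R : comPzSemiRingType) (N : nat)
    (I t : 'I_N -> nat) (D : tensor R t) (U : forall n, 'M[R]_(I n, t n))
    (V : forall n, 'M[R]_(t n, I n)) (r : N.-tuple nat) :
    (forall n, V n *m U n = 1%:M) ->
  admissible (tucker D U) r <-> admissible D r.
Proof.
move=> VU; split; last exact: admissible_tucker.
suff {2}-> : D = tucker (tucker D U) V by apply: admissible_tucker.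
by rewrite tucker_comp -[LHS]tucker1; apply/ffunP => i;
  rewrite !tuckerE; under eq_bigr do under eq_bigr do rewrite -VU.
Qed.

Lemma MtpRank_congr (R : comPzSemiRingType) (N : nat) (I J : 'I_N -> nat)
    (X : tensor R I) (Y : tensor R J) : (3 <= N)%N ->
    (forall r, admissible X r <-> admissible Y r) ->
  MtpRank X = MtpRank Y.
Proof.
move=> N3 XY.
have gE : GTriRank X = GTriRank Y.
  have [gX AX minX] := GTriRankP X N3; have [gY AY minY] := GTriRankP Y N3.
  by apply/eqP; rewrite eqn_leq minX ?minY //; apply/XY.
have cand r : MtpRank_candidate X r <-> MtpRank_candidate Y r.
  by rewrite /MtpRank_candidate gE XY.
have [CX minX] := MtpRankP X N3.
apply: (is_MtpRank_uniq _ (MtpRankP Y N3)).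
by split=> [|s /cand /minX]; first exact/cand.
Qed.

(** The modes other than z number at least two, so a cyclic shift of them has no
    fixed point. *)
Lemma derangement_fixing (N : nat) (z : 'I_N) : (3 <= N)%N ->
  exists s : 'S_N, s z = z /\ forall n, n != z -> s n != n.
Proof.
case: N z => // N z; rewrite ltnS => N2.
exists (lift_perm z z (perm (@ordS_inj N))); split=> [|n nz].
  exact: lift_perm_id.
have [k ->] : exists k : 'I_N, n = lift z k.
  by case: (unliftP z n) nz => [k ->|->]; [exists k | rewrite eqxx].
rewrite lift_perm_lift (inj_eq lift_inj) permE -val_eqE /=.
have := ltn_ord k; rewrite leq_eqVlt => /predU1P[kN|kN].
  by rewrite kN modnn eq_sym -lt0n -ltnS kN.
by rewrite modn_small // gtn_eqF.
Qed.

Lemma other_ord (N : nat) (z : 'I_N) : (2 <= N)%N -> exists u, u != z.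
Proof.
move=> N2; pose a := Ordinal (ltnW N2); pose b := Ordinal N2.
by have [za|] := eqVneq a z; [exists b; rewrite -za | exists a].
Qed.

(** The factor of each mode n != z transmits i_n to the factor of mode z through
    the summation index p_(s n); this is possible because s n != n, so the
    n-th factor sees p_(s n), and s n != z, so the z-th factor sees it too. *)
Lemma admissible_but_one (R : comPzSemiRingType) (N : nat)
    (I : 'I_N -> nat) (X : tensor R I) (r : N.-tuple nat) (z : 'I_N) :
    (3 <= N)%N -> (forall n, 0 < tnth r n)%N ->
    (forall m n, m != z -> (I m <= tnth r n)%N) ->
  admissible X r.
Proof.
move=> N3 r0 Ir; have [s [sz sn]] := derangement_fixing z N3.
have snz n : n != z -> s n != z by rewrite -{2}sz (inj_eq perm_inj).
have svz m : m != z -> (s^-1)%g m != z.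
  by apply: contra_neq => e; rewrite -(permKV s m) e sz.
apply/admissibleP; split=> //.
(* No index is transmitted through p z; it is forced to be 0 so that exactly one
   p contributes. The sum over j has one term, the entry of X at the transmitted
   index, or none when a p (s m) is outside the dimension I m. *)
exists (fun n (k : 'I_(I n)) (p : midx (tnth r)) =>
  if n == z then \sum_(j : {dffun forall m, 'I_(I m)} | (j n == k) &&
      [forall m, (m != z) ==> (j m == p (s m) :> nat)]) X j
  else ((p (s n) == k :> nat) && (p z == 0 :> nat))%:R); split=> [n k p p' pp|i].
  case: eqP => [nz|/eqP nz]; last by rewrite !pp ?sn // eq_sym.
  apply: eq_bigl => j; congr (_ && _); apply: eq_forallb => m.
  by case: eqVneq => //= mz; rewrite pp // nz snz.
pose p0 : midx (tnth r) := finfun (fun m =>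
  insubd (Ordinal (r0 m)) (if m == z then 0 else i ((s^-1)%g m) : nat)%N).
have p0z : p0 z = 0%N :> nat by rewrite ffunE eqxx val_insubd r0.
have p0s n : n != z -> p0 (s n) = i n :> nat.
  move=> nz; rewrite ffunE (negbTE (snz n nz)) permK val_insubd.
  by rewrite (leq_trans (ltn_ord _)) // Ir.
rewrite (bigD1 p0) //= [X in _ = _ + X]big1 ?addr0.
  rewrite (bigD1 z) //= eqxx [X in _ = _ * X]big1 ?mulr1; last first.
    by move=> n nz; rewrite (negbTE nz) p0s // p0z !eqxx.
  rewrite (big_pred1 i) // => j; apply/andP/eqP => [[/eqP jz /forallP h]|->].
    apply/ffunP => m; apply/val_inj; have [->|mz] := eqVneq m z; first by rewrite jz.
    by have /implyP/(_ mz)/eqP/= -> := h m; rewrite p0s.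
  by split=> //; apply/forallP => m; apply/implyP => mz; rewrite p0s.
move=> p /eqP pp0.
have [h|/forallPn[n]] := boolP [forall n, (n != z) ==>
    ((p (s n) == i n :> nat) && (p z == 0 :> nat))]; last first.
  rewrite negb_imply => /andP[nz /negbTE h].
  by rewrite (bigD1 n) //= (negbTE nz) h mul0r.
case: pp0; apply/ffunP => m; apply/val_inj => /=.
have hn n (nz : n != z) := andP (implyP (forallP h n) nz).
have [->|mz] := eqVneq m z.
  have [u uz] := other_ord z (ltnW N3).
  by have [_ /eqP ->] := hn u uz; rewrite p0z.
by rewrite -(permKV s m) p0s ?svz //; have [/eqP ->] := hn _ (svz m mz).
Qed.

(** The exception z is the mode that is first in decreasing order of the t m. *)
Lemma leq_submax_but_one (N : nat) (t : N.-tuple nat) : (2 <= N)%N ->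
  exists z : 'I_N, forall m, m != z -> (tnth t m <= submax t)%N.
Proof.
move=> N2; have /tuple_permP[p pE] : perm_eq t (sort_tuple geq t).
  by rewrite perm_sym perm_sort.
have tE m : tnth t m = nth 0%N (sort geq t) (p m).
  by rewrite (tnth_nth 0%N) {1}pE -tnth_nth tnth_mktuple (tnth_nth 0%N).
have sz : size (sort geq t) = N by rewrite size_sort size_tuple.
exists ((p^-1)%g (Ordinal (ltnW N2))) => m mz; rewrite tE.
have geqT : total geq by move=> a b; apply: leq_total.
have geq_tr : transitive geq by move=> a b c ba cb; apply: leq_trans cb ba.
apply: (sorted_leq_nth geq_tr leqnn 0%N (sort_sorted geqT t)).
- by rewrite inE sz.
- by rewrite inE sz.
rewrite lt0n; apply: contraNneq mz => pm0; apply/eqP.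
by apply: (canRL (permK p)); apply/val_inj.
Qed.

Theorem theorem3p5 (R : realType) (N : nat) (hN : (3 <= N)%N)
    (I : 'I_N -> nat) (X : tensor R I) (hX : X != 0)
    (t : N.-tuple nat) (ht : TuckRank X = t)
    (D : tensor R (tnth t)) (U : forall n : 'I_N, 'M[R]_(I n, tnth t n))
    (hXD : X = tucker D U)
    (hU : forall n : 'I_N, (U n)^T *m U n \in unitmx) :
  MtpRank X = MtpRank D /\
  forall n : 'I_N, (tnth (MtpRank X) n <= submax t)%N.
Proof.
have UE n : (invmx ((U n)^T *m U n) *m (U n)^T) *m U n = 1%:M.
  by rewrite -mulmxA mulVmx.
have XD r : admissible X r <-> admissible D r.
  by rewrite hXD; apply: admissible_tucker_inj UE.
have XDE : MtpRank X = MtpRank D by apply: MtpRank_congr.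
split=> // n.
(* X != 0 has a nonzero entry, a sum over the entries of D: so D has entries. *)
have t0 m : (0 < tnth t m)%N.
  case: (posnP (tnth t m)) => // tm0; case/negP: hX; apply/eqP/ffunP => j.
  rewrite hXD tuckerE big1 ?ffunE // => p _.
  by have := ltn_ord (p m); rewrite [X in (_ < X)%N]tm0.
have [z tz] := leq_submax_but_one t (ltnW hN).
have [[_ leG] _] := MtpRankP X hN; apply: leq_trans (leG n) _.
have [_ _ minG] := GTriRankP X hN.
have s0 : (0 < submax t)%N.
  have [u /tz] := other_ord z (ltnW hN); exact: leq_trans.
apply: minG => //; apply/XD/(@admissible_but_one _ _ _ _ _ z) => // [m|m k mz].
  by rewrite tnth_nseq.
by rewrite tnth_nseq tz.
Qed.
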